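(* For every positive integer $n$ and every simple hypergraph $H=([n],E)$ all of whose edges are nonempty, $$\bigl|\operatorname{vert}P_{\mathrm{fpm}}(H)\bigr|\leq B_n .$$ As a consequence, $\bigl|\operatorname{vert}P_{\mathrm{fpm}}(H)\bigr|=O\!\left(2^{n^2-n}/n!\right)$ as $n\to\infty$, uniformly in $H$ (that is, the implied constant does not depend on $H$).
   Context: A simple hypergraph $H=([n],E)$ has vertex set $[n]=\{1,\dots,n\}$ and a set $E\subseteq 2^{[n]}$ of (distinct) edges. Its incidence matrix $A_H\in\{0,1\}^{[n]\times E}$ has $(A_H)_{i,e}=1$ if $i\in e$ and $0$ otherwise. The fractional perfect-matching polytope of $H$ is $P_{\mathrm{fpm}}(H):=\{x\in\mathbb{R}_{\ge 0}^{E}: A_Hx=\mathbf{1}\}$, where $\mathbf{1}=(1,\dots,1)^{\mathsf T}\in\mathbb{R}^n$, and $\operatorname{vert}P$ denotes the set of vertices (extreme points) of a polytope $P$. A collection $\Phi\subseteq 2^{[n]}$ is balanced if there exist positive real weights $(\lambda_S)_{S\in\Phi}$ with $\sum_{S\in\Phi}\lambda_S\mathbf{1}_S=\mathbf{1}$, where $\mathbf{1}_S$ is the characteristic vector of $S$. A balanced collection is minimal if none of its proper subcollections is balanced. $B_n$ is the number of minimal balanced collections on $[n]$. *)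

(* Defs.v *)
From HB Require Import structures.
From mathcomp Require Import all_boot all_order all_algebra.
From mathcomp Require Import finmap.
From mathcomp Require Import all_classical all_reals all_analysis.

Set Implicit Arguments.
Unset Strict Implicit.
Unset Printing Implicit Defensive.

Import Order.TTheory GRing.Theory Num.Theory.
Import numFieldNormedType.Exports.

Local Open Scope classical_set_scope.
Local Open Scope ring_scope.

(* The vertex set [n] is rendered as 'I_n and a simple hypergraph on it by its
   edge set E : {set {set 'I_n}}. *)

Definition char_vec (R : realType) (n : nat) (S : {set 'I_n}) : 'cV[R]_n :=
  \col_i (i \in S)%:R.

(* Columns are indexed by 'I_#|E|, where j stands for the edge enum_val j;
   this identifies R^E with 'cV[R]_#|E|. *)
Definition incidence_mx (R : realType) (n : nat) (E : {set {set 'I_n}}) :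
    'M[R]_(n, #|E|) :=
  \matrix_(i < n, j < #|E|) (i \in (enum_val j : {set 'I_n}))%:R.

Definition Pfpm (R : realType) (n : nat) (E : {set {set 'I_n}}) :
    set 'cV[R]_#|E| :=
  [set x : 'cV[R]_#|E| | (forall j, 0 <= x j 0) /\ incidence_mx R E *m x = const_mx 1].

Arguments Pfpm R {n} E _.

Definition extreme_points (R : realType) (V : lmodType R) (P : set V) : set V :=
  [set x | P x /\
    forall (y z : V) (t : R), P y -> P z -> 0 < t -> t < 1 ->
      x = t *: y + (1 - t) *: z -> y = z].

(* fset_set is a junk value on infinite sets, so this is the number of vertices
   only once the set of vertices is known to be finite. *)
Definition num_vert_Pfpm (R : realType) (n : nat) (E : {set {set 'I_n}}) : nat :=
  #|` fset_set (extreme_points (Pfpm R E))|.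

Definition balanced (R : realType) (n : nat) (Phi : {set {set 'I_n}}) : Prop :=
  exists lambda : {set 'I_n} -> R,
    (forall S, S \in Phi -> 0 < lambda S) /\
    \sum_(S in Phi) lambda S *: char_vec R S = const_mx 1.

Definition minimal_balanced (R : realType) (n : nat)
    (Phi : {set {set 'I_n}}) : Prop :=
  balanced R Phi /\
  forall Psi : {set {set 'I_n}}, Psi \proper Phi -> ~ balanced R Psi.

Definition num_minimal_balanced (R : realType) (n : nat) : nat :=
  #|[pred Phi : {set {set 'I_n}} | `[< minimal_balanced R Phi >]]|.

(* Main.v *)
Require Import Defs.
From HB Require Import structures.
From mathcomp Require Import all_boot all_order all_algebra.
From mathcomp Require Import finmap.
From mathcomp Require Import all_classical all_reals all_analysis.
From mathcomp Require Import lra zify.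

(* A vertex of the polytope is determined by its support, and the support is a
   minimal balanced collection; both facts follow by perturbing the vertex along
   a kernel vector of the incidence matrix supported inside it. For the bound on
   B_n, identify each S with its complement, leaving M = 2^(n-1) classes. Modulo
   the all-one vector, complementing S negates its characteristic vector, and a
   minimal balanced collection carries only one relation up to scale, so it is
   determined by its classes up to complementing all its members at once. It has
   at most n members, hence B_n <= 2 * sum_(k <= n) C(M, k), which is at most
   4 * M^n / n! as soon as 2n <= M. *)

Set Implicit Arguments.
Unset Strict Implicit.
Unset Printing Implicit Defensive.

Import Order.TTheory GRing.Theory Num.Theory.
Import numFieldNormedType.Exports.

Local Open Scope classical_set_scope.
Local Open Scope ring_scope.

(** * Linear independence and uniqueness of weights *)

(** Moving the positive weights along a relation with a positive coefficient until a first weight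
    vanishes would balance a proper subcollection. So no coefficient is positive, and the opposite
    relation gives the other sign. *)
Lemma minimal_balanced_free (R : realType) n (Phi : {set {set 'I_n}})
    (nu : {set 'I_n} -> R) :
  minimal_balanced R Phi -> \sum_(S in Phi) nu S *: char_vec R S = 0 ->
  {in Phi, forall S, nu S = 0}.
Proof.
move=> [[lambda [lambda_gt0 sum_lambda]] min_Phi].
have nu_le0 (mu : {set 'I_n} -> R) :
    \sum_(S in Phi) mu S *: char_vec R S = 0 -> {in Phi, forall S, mu S <= 0}.
  move=> sum_mu S0 PhiS0; rewrite leNgt; apply/negP => muS0_gt0.
  pose P S := (S \in Phi) && (0 < mu S).
  have PS0 : P S0 by rewrite /P PhiS0.
  (* Ratio test: [t] below is the largest step keeping every [lambda S - t * mu S] nonnegative, and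
     the weight of [S1] then vanishes. *)
  case: (arg_minP (P := P) (fun S => lambda S / mu S) PS0) =>
    S1 /andP[PhiS1 muS1_gt0] S1_min.
  set t := lambda S1 / mu S1.
  have t_gt0 : 0 < t by rewrite divr_gt0 ?lambda_gt0.
  pose w S := lambda S - t * mu S.
  have w_ge0 S : S \in Phi -> 0 <= w S.
    move=> PhiS; rewrite subr_ge0.
    have [muS_gt0|muS_le0] := ltP 0 (mu S).
      by rewrite -ler_pdivlMr ?S1_min// /P PhiS.
    by rewrite (le_trans _ (ltW (lambda_gt0 _ PhiS))) ?pmulr_rle0.
  apply: (min_Phi [set S in Phi | 0 < w S]).
    apply/properP; split; first by apply/fintype.subsetP => S; rewrite inE => /andP[].
    by exists S1 => //; rewrite inE PhiS1 /w /t divfK ?gt_eqF// subrr ltxx.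
  exists w; split; first by move=> S; rewrite inE => /andP[].
  have <- : \sum_(S in Phi) w S *: char_vec R S = const_mx 1.
    transitivity (\sum_(S in Phi) lambda S *: char_vec R S -
                  t *: \sum_(S in Phi) mu S *: char_vec R S).
      rewrite scaler_sumr -sumrB.
      by apply: eq_bigr => S _; rewrite scalerA -scalerBl.
    by rewrite sum_lambda sum_mu scaler0 subr0.
  rewrite [RHS](bigID (fun S => 0 < w S))/= [X in _ = _ + X]big1 ?addr0.
    by apply: eq_bigl => S; rewrite inE.
  move=> S /andP[PhiS]; rewrite -leNgt => wS_le0.
  by have /le_anti-> : w S <= 0 <= w S; rewrite ?scale0r ?wS_le0 ?w_ge0.
move=> sum_nu S PhiS; apply/le_anti; rewrite nu_le0//=.
rewrite -oppr_le0 (nu_le0 (fun S => - nu S))//.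
by under eq_bigr do rewrite scaleNr; rewrite sumrN sum_nu oppr0.
Qed.

Lemma minimal_balanced_weights (R : realType) n (Phi : {set {set 'I_n}})
    (lambda mu : {set 'I_n} -> R) (c : R) :
  minimal_balanced R Phi ->
  \sum_(S in Phi) lambda S *: char_vec R S = const_mx 1 ->
  \sum_(S in Phi) mu S *: char_vec R S = const_mx c ->
  {in Phi, forall S, mu S = c * lambda S}.
Proof.
move=> minPhi sum_lambda sum_mu S PhiS.
apply/eqP; rewrite -subr_eq0; apply/eqP.
apply: (minimal_balanced_free (nu := fun S => mu S - c * lambda S) minPhi) => //.
rewrite (eq_bigr (fun S => mu S *: char_vec R S - c *: (lambda S *: char_vec R S))).
  rewrite sumrB -scaler_sumr sum_lambda sum_mu.
  by apply/matrixP => i j; rewrite !mxE mulr1 subrr.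
by move=> T _; rewrite scalerBl scalerA.
Qed.

Lemma minimal_balanced_subset_eq (R : realType) n (Phi Psi : {set {set 'I_n}}) :
  minimal_balanced R Phi -> balanced R Psi -> Psi \subset Phi -> Psi = Phi.
Proof.
move=> [_ minPhi] balPsi sub; apply/eqP; apply: contrapT => /negP neq.
by apply: (minPhi Psi) => //; rewrite finset.properEneq neq.
Qed.

(** * Complementing members of a collection *)

Lemma char_vecC (R : realType) n (S : {set 'I_n}) :
  char_vec R (~: S) = const_mx 1 - char_vec R S.
Proof.
by apply/matrixP => i j; rewrite !mxE inE; case: (i \in S); rewrite ?subrr ?subr0.
Qed.

Lemma balanced_pairC (R : realType) n (S : {set 'I_n}) :
  (0 < n)%N -> balanced R [set S; ~: S]%SET.
Proof.
case: n S => // n S _; exists (fun=> 1); split=> //.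
rewrite big_setU1 ?big_set1/=; first by rewrite !scale1r char_vecC addrC subrK.
rewrite inE; apply/eqP => /setP/(_ ord0); rewrite inE.
by case: (_ \in _).
Qed.

(** The characteristic vectors of the members are linearly independent in a space of dimension
    [n]. *)
Lemma card_minimal_balanced (R : realType) n (Phi : {set {set 'I_n}}) :
  minimal_balanced R Phi -> (#|Phi| <= n)%N.
Proof.
move=> minPhi.
have : row_free (incidence_mx R Phi)^T.
  apply: inj_row_free => v v0.
  have [Phi0|[S0 PhiS0]] := finset.set_0Vmem Phi.
    have card0 : #|Phi| = 0%N by rewrite Phi0 cards0.
    by apply/rowP => j; have := ltn_ord j; lia.
  pose nu S := v 0 (enum_rank_in PhiS0 S).
  suff nu0 : {in Phi, forall S, nu S = 0}.
    apply/rowP => j; rewrite mxE -(enum_valK_in PhiS0 j).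
    exact/nu0/enum_valP.
  apply: minimal_balanced_free => //.
  apply/matrixP => i j; rewrite summxE big_enum_val.
  transitivity ((v *m (incidence_mx R Phi)^T) 0 i); last by rewrite v0 !mxE.
  rewrite mxE.
  by apply: eq_bigr => k _; rewrite !mxE /nu enum_valK_in.
by rewrite /row_free => /eqP <-; exact: rank_leq_col.
Qed.

(* Replacing S by its complement negates its characteristic vector modulo the
   all-one vector, so a positive relation on Phi' is a signed relation on Phi;
   by uniqueness of weights all its signs agree with the one at s. *)
Lemma minimal_balanced_flip_subset (R : realType) n
    (Phi Phi' : {set {set 'I_n}}) (s : {set 'I_n}) :
  (0 < n)%N -> minimal_balanced R Phi -> minimal_balanced R Phi' ->
  {in Phi, forall S, (S \in Phi') || (~: S \in Phi')} ->
  {in Phi', forall S, (S \in Phi) || (~: S \in Phi)} ->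
  s \in Phi -> s \in Phi' -> Phi \subset Phi'.
Proof.
move=> n_gt0 minPhi minPhi' PhiPhi' Phi'Phi Phis Phi's.
(* If [Phi'] contains both [s] and its complement, this balanced pair is all of [Phi'] by
   minimality. *)
have [Phi'sC|Phi'sC] := boolP (~: s \in Phi').
  have Phi'E : [set s; ~: s]%SET = Phi'.
    apply: (minimal_balanced_subset_eq minPhi'); first exact: balanced_pairC.
    by apply/fintype.subsetP => S; rewrite !inE => /orP[]/eqP->.
  apply/fintype.subsetP => S /PhiPhi'; rewrite -Phi'E !inE.
  case/orP => // /orP[]/eqP SC; last by rewrite (finset.setC_inj SC) eqxx.
  by rewrite -SC finset.setCK eqxx orbT.
have [[lambda [lambda_gt0 sum_lambda]] _] := minPhi.
have [[lambda' [lambda'_gt0 sum_lambda']] _] := minPhi'.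
(* A member of [Phi'] outside [Phi] has its complement in [Phi], so its weight is moved there with a
   minus sign; each such move takes [lambda' S] off the all-one vector, leaving [c]. *)
pose mu S := (if S \in Phi' then lambda' S else 0) -
             (if ~: S \in Phi' :\: Phi then lambda' (~: S) else 0).
pose c := 1 - \sum_(S in Phi' :\: Phi) lambda' S.
have sum_mu : \sum_(S in Phi) mu S *: char_vec R S = const_mx c.
  rewrite (eq_bigr _ (fun S _ => scalerBl _ _ _)) sumrB.
  have -> : \sum_(S in Phi) (if S \in Phi' then lambda' S else 0) *: char_vec R S =
            \sum_(S in Phi' :&: Phi) lambda' S *: char_vec R S.
    rewrite [RHS](eq_bigl (fun S => (S \in Phi) && (S \in Phi'))); last first.
      by move=> S; rewrite inE andbC.
    rewrite big_mkcondr; apply: eq_bigr => S _.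
    by case: ifP => // _; rewrite scale0r.
  have -> : \sum_(S in Phi) (if ~: S \in Phi' :\: Phi then lambda' (~: S) else 0)
              *: char_vec R S =
            \sum_(S in Phi' :\: Phi) lambda' S *: (const_mx 1 - char_vec R S).
    rewrite [RHS](reindex_inj (can_inj (@finset.setCK _)))/=.
    rewrite [RHS](eq_bigl (fun S => (S \in Phi) && (~: S \in Phi' :\: Phi))); last first.
      move=> S; rewrite inE; have [//|PhiS] := boolP (S \in Phi).
      apply/negbTE/negP => /andP[/negbTE PhiSC /Phi'Phi].
      by rewrite PhiSC finset.setCK (negbTE PhiS).
    rewrite big_mkcondr; apply: eq_bigr => S _.
    by case: ifP => _; rewrite ?scale0r// -char_vecC finset.setCK.
  rewrite (eq_bigr _ (fun S _ => scalerBr _ _ _)) sumrB opprB addrA.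
  rewrite -big_setID/= sum_lambda' -scaler_suml.
  by apply/matrixP => i j; rewrite !mxE mulr1.
have muE := minimal_balanced_weights minPhi sum_lambda sum_mu.
have c_gt0 : 0 < c.
  rewrite -(pmulr_lgt0 _ (lambda_gt0 _ Phis)) -muE// /mu Phi's.
  by rewrite inE (negbTE Phi'sC) andbF subr0 lambda'_gt0.
(* Off [Phi'] only the subtracted term of [mu S] can survive, which contradicts
   [mu S = c * lambda S > 0]. *)
apply/fintype.subsetP => S PhiS; apply: contraT => /negbTE Phi'S.
have : 0 < mu S by rewrite muE// mulr_gt0 ?lambda_gt0.
rewrite /mu Phi'S sub0r; case: ifP => [|_]; last by rewrite oppr0 ltxx.
rewrite inE => /andP[_ /lambda'_gt0 lt0].
by rewrite oppr_gt0 ltNge ltW.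
Qed.


(** * Counting minimal balanced collections by complementary pairs *)

Lemma card_subsets_leq (T : finType) (B : {set T}) n :
  (#|[set A : {set T} | (A \subset B) && (#|A| <= n)%N]%SET| <=
   \sum_(k < n.+1) 'C(#|B|, k))%N.
Proof.
elim: n => [|n IHn].
  rewrite big_ord1 -cards_draws; apply/subset_leq_card/fintype.subsetP => A.
  by rewrite !inE leqn0.
rewrite big_ord_recr/= -cards_draws (leq_trans _ (leq_add IHn (leqnn _)))//.
rewrite (leq_trans _ (leq_card_setU _ _).1)//.
apply/subset_leq_card/fintype.subsetP => A; rewrite !inE => /andP[-> /=].
by rewrite leq_eqVlt ltnS orbC.
Qed.

Definition pair_rep m (S : {set 'I_m.+1}) : {set 'I_m.+1} :=
  if ord0 \in S then S else ~: S.

Lemma pair_repP m (S T : {set 'I_m.+1}) :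
  pair_rep S = pair_rep T -> S = T \/ ~: S = T.
Proof.
rewrite /pair_rep; case: ifP; case: ifP => _ _.
- by left.
- by move=> ->; right; rewrite finset.setCK.
- by right.
- by move=> /finset.setC_inj; left.
Qed.

Lemma minimal_balanced_pair_rep_inj (R : realType) m
    (Phi Phi' : {set {set 'I_m.+1}}) (s : {set 'I_m.+1}) :
  minimal_balanced R Phi -> minimal_balanced R Phi' ->
  [set pair_rep S | S in Phi]%SET = [set pair_rep S | S in Phi']%SET ->
  s \in Phi -> s \in Phi' -> Phi = Phi'.
Proof.
move=> minPhi minPhi' repE Phis Phi's.
have flip (Psi Psi' : {set {set 'I_m.+1}}) :
    [set pair_rep S | S in Psi]%SET = [set pair_rep S | S in Psi']%SET ->
    {in Psi, forall S, (S \in Psi') || (~: S \in Psi')}.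
  move=> PsiE S PsiS.
  have /imsetP[T Psi'T /pair_repP] : pair_rep S \in [set pair_rep S | S in Psi']%SET.
    by rewrite -PsiE imset_f.
  by case=> ->; rewrite Psi'T ?orbT.
apply/eqP; rewrite finset.eqEsubset; apply/andP; split.
  by apply: (minimal_balanced_flip_subset _ minPhi minPhi' _ _ Phis) => //; apply: flip.
by apply: (minimal_balanced_flip_subset _ minPhi' minPhi _ _ Phi's) => //; apply: flip.
Qed.

(** The bit fixes the orientation. The tested [t] depends on the classes alone, so collections with
    the same classes are compared at the same set; the default [false] arises only for empty
    [Phi]. *)
Definition pair_code m (Phi : {set {set 'I_m.+1}}) : {set {set 'I_m.+1}} * bool :=
  let T := [set pair_rep S | S in Phi]%SET in
  (T, if [pick t in T] is Some t then t \in Phi else false).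

Lemma pair_code_inj (R : realType) m :
  {in [pred Phi | `[< minimal_balanced R Phi >]] &, injective (@pair_code m)}.
Proof.
move=> Phi Phi' /asboolP minPhi /asboolP minPhi' [repE].
rewrite -repE; case: pickP => [t t_rep tE|rep0 _]; last first.
  have [->|[S PhiS]] := finset.set_0Vmem Phi; last first.
    by have := rep0 (pair_rep S); rewrite imset_f.
  have [->//|[S Phi'S]] := finset.set_0Vmem Phi'.
  by have := rep0 (pair_rep S); rewrite repE imset_f.
(* If [t] is not a member, its complement is; equal bits thus provide a common member, [t] or
   [~: t]. *)
have mem (Psi : {set {set 'I_m.+1}}) : t \in [set pair_rep S | S in Psi]%SET ->
    t \notin Psi -> ~: t \in Psi.
  move=> /imsetP[S PsiS ->]; rewrite /pair_rep; case: ifP => _; first by rewrite PsiS.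
  by rewrite finset.setCK.
have [Phit|Phit] := boolP (t \in Phi).
  by apply: (minimal_balanced_pair_rep_inj minPhi minPhi' repE Phit); rewrite -tE.
apply: (minimal_balanced_pair_rep_inj minPhi minPhi' repE (s := ~: t)).
  exact: mem.
by apply: mem; rewrite -?repE// -tE.
Qed.

Lemma card_sets_with_ord0 m : (#|[set S : {set 'I_m.+1} | ord0 \in S]%SET| <= 2 ^ m)%N.
Proof.
have -> : (2 ^ m)%N = #|powerset [set~ ord0 : 'I_m.+1]%SET|.
  by rewrite card_powerset cardsC1 card_ord.
rewrite -[leqLHS](card_in_imset (f := fun S => S :\ (ord0 : 'I_m.+1))%SET); last first.
  move=> S T; rewrite !inE => S0 T0 STE.
  by rewrite -(finset.setD1K S0) -(finset.setD1K T0) STE.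
apply/subset_leq_card/fintype.subsetP => _ /imsetP[S _ ->].
by rewrite inE; apply/fintype.subsetP => i; rewrite !inE => /andP[].
Qed.

(** The factor 2 counts the orientation bit, and the sum counts sets of at most [m.+1] classes among
    the [2 ^ m] ones. *)
Lemma num_minimal_balanced_leq (R : realType) m :
  (num_minimal_balanced R m.+1 <= 2 * \sum_(k < m.+2) 'C(2 ^ m, k))%N.
Proof.
pose B := [set S : {set 'I_m.+1} | ord0 \in S]%SET.
pose D := [set A : {set {set 'I_m.+1}} | (A \subset B) && (#|A| <= m.+1)%N]%SET.
have codeD Phi : minimal_balanced R Phi -> pair_code Phi \in finset.setX D [set: bool]%SET.
  move=> minPhi; rewrite !inE andbT (leq_trans (leq_imset_card _ _))/=; last first.
    exact: card_minimal_balanced minPhi.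
  rewrite andbT; apply/fintype.subsetP => _ /imsetP[S _ ->]; rewrite inE /pair_rep.
  by case: ifP => //; rewrite inE => ->.
rewrite /num_minimal_balanced -(card_in_imset (@pair_code_inj R m)).
apply: (@leq_trans #|finset.setX D [set: bool]%SET|).
  by apply/subset_leq_card/fintype.subsetP => _ /imsetP[Phi /asboolP minPhi ->]; exact: codeD.
rewrite cardsX cardsT card_bool mulnC leq_mul2l/= (leq_trans (card_subsets_leq _ _))//.
by apply: leq_sum => k _; rewrite leq_bin2l ?card_sets_with_ord0.
Qed.

(** * Asymptotic estimate *)

Lemma bin_le_exp_fact (R : realType) (M k : nat) : 'C(M, k)%:R <= M%:R ^+ k / k`!%:R :> R.
Proof.
rewrite ler_pdivlMr ?ltr0n ?fact_gt0// -natrM bin_ffact -natrX ler_nat.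
elim: k => // k IHk; rewrite ffactnSr expnSr leq_mul ?leq_subr//.
Qed.

(* Once 2 k <= M the terms M^k / k! at least double at each step, so the last
   one dominates the sum. *)
Lemma sum_bin_le (R : realType) (M n : nat) : (2 * n <= M)%N ->
  (\sum_(k < n.+1) 'C(M, k))%:R <= 2 * (M%:R ^+ n / n`!%:R) :> R.
Proof.
elim: n => [|n IHn] nM.
  by rewrite big_ord1 bin0 expr0 fact0 divr1 mulr1 ler1n.
rewrite big_ord_recr/= natrD.
have {}IHn : (\sum_(k < n.+1) 'C(M, k))%:R <= 2 * (M%:R ^+ n / n`!%:R) :> R.
  by apply: IHn; lia.
rewrite (le_trans (lerD IHn (bin_le_exp_fact R M n.+1)))//.
set a := M%:R ^+ n / n`!%:R in IHn *.
have a_ge0 : 0 <= a by rewrite divr_ge0 ?exprn_ge0.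
have -> : M%:R ^+ n.+1 / n.+1`!%:R = a * (M%:R / n.+1%:R) :> R.
  by rewrite exprSr factS mulnC natrM /a invfM mulrACA.
have : 2 <= M%:R / n.+1%:R :> R by rewrite ler_pdivlMr ?ltr0n// -natrM ler_nat.
by move=> /(ler_wpM2l a_ge0); move: (a * (_ / _)) => r; lra.
Qed.

Lemma num_minimal_balanced_le (R : realType) n : (5 <= n)%N ->
  (num_minimal_balanced R n)%:R <= 4 * (2 ^+ (n ^ 2 - n)%N / n`!%:R) :> R.
Proof.
case: n => // m m_ge4.
(* This is the condition of [sum_bin_le] for [M = 2 ^ m]; the induction starts at [m = 4], where it
   reads [10 <= 16]. *)
have exp_ge : (2 * m.+1 <= 2 ^ m)%N.
  elim: m m_ge4 => // m IHm; rewrite leq_eqVlt => /orP[/eqP[<-]//|/IHm].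
  by rewrite expnS; lia.
rewrite (le_trans (y := (2 * \sum_(k < m.+2) 'C(2 ^ m, k))%:R))//.
  by rewrite ler_nat num_minimal_balanced_leq.
have := sum_bin_le R exp_ge; rewrite natrM natrX -exprM.
have -> : (m * m.+1 = m.+1 ^ 2 - m.+1)%N by rewrite -mulnn; lia.
lra.
Qed.

(** * Vertices of the polytope and their supports *)

(** Reads a vector indexed by ['I_#|E|] as a function on sets: the sum has one term for an edge and
    is empty, hence 0, off [E]. *)
Definition edge_weight (R : realType) n (E : {set {set 'I_n}}) (x : 'cV[R]_#|E|)
  (S : {set 'I_n}) : R := \sum_(j | enum_val j == S) x j 0.

Lemma edge_weight_enum_val (R : realType) n (E : {set {set 'I_n}})
  (x : 'cV[R]_#|E|) j : edge_weight x (enum_val j) = x j 0.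
Proof.
rewrite /edge_weight (big_pred1 j) // => k; exact: (inj_eq enum_val_inj).
Qed.

Lemma incidence_mx_mul (R : realType) n (E : {set {set 'I_n}}) (x : 'cV[R]_#|E|)
    (f : {set 'I_n} -> R) : (forall j, f (enum_val j) = x j 0) ->
  incidence_mx R E *m x = \sum_(S in E) f S *: char_vec R S.
Proof.
move=> fE; apply/matrixP => i j; rewrite summxE big_enum_val mxE ord1.
by apply: eq_bigr => k _; rewrite !mxE fE mulrC.
Qed.

Definition support (R : realType) n (E : {set {set 'I_n}}) (x : 'cV[R]_#|E|) :
  {set {set 'I_n}} := [set S in E | edge_weight x S != 0]%SET.

Lemma enum_val_support (R : realType) n (E : {set {set 'I_n}}) (x : 'cV[R]_#|E|) j :
  (enum_val j \in support x) = (x j 0 != 0).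
Proof. by rewrite inE enum_valP edge_weight_enum_val. Qed.

(** Small steps along [d] and [- d] both stay in the polytope, with [x] as their midpoint. *)
Lemma extreme_point_perturb (R : realType) n (E : {set {set 'I_n}})
    (x d : 'cV[R]_#|E|) :
  extreme_points (Pfpm R E) x -> incidence_mx R E *m d = 0 ->
  (forall j, x j 0 = 0 -> d j 0 = 0) -> d = 0.
Proof.
move=> [[x_ge0 Ax] extr] Ad supp_d.
(* [K] dominates every ratio [|d_j| / x_j], and the 1 makes it positive. Where [x_j = 0] the
   quotient is 0 by convention, harmlessly since [d_j = 0] there. *)
pose K := 1 + \sum_j `|d j 0| / x j 0.
have term_ge0 j : 0 <= `|d j 0| / x j 0 by rewrite divr_ge0.
have K_gt0 : 0 < K by rewrite ltr_wpDr// sumr_ge0.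
have d_le j : `|K^-1 * d j 0| <= x j 0.
  rewrite normrM gtr0_norm ?invr_gt0// mulrC ler_pdivrMr//.
  have [xj0|xj0] := eqVneq (x j 0) 0; first by rewrite xj0 supp_d// normr0 mul0r.
  have xj_gt0 : 0 < x j 0 by rewrite lt_def xj0 x_ge0.
  rewrite mulrC -ler_pdivrMr// /K (bigD1 j)//= addrCA lerDl addr_ge0// sumr_ge0//.
have in_P (s : R) : `|s| = 1 -> Pfpm R E (x + (s * K^-1) *: d).
  move=> s1; split.
    move=> j; rewrite !mxE -mulrA -lerBlDl sub0r lerNnormlW//.
    by rewrite normrM s1 mul1r.
  by rewrite mulmxDr -scalemxAr Ad scaler0 addr0.
have : x + (1 * K^-1) *: d = x + (- 1 * K^-1) *: d.
  have half_gt0 : 0 < 2^-1 :> R by lra.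
  have half_lt1 : 2^-1 < 1 :> R by lra.
  apply: (extr _ _ 2^-1 (in_P _ _) (in_P _ _)); rewrite ?normrN ?normr1//.
  by apply/matrixP => i j; rewrite !mxE; lra.
move=> /addrI /eqP; rewrite -subr_eq0 -scalerBl scaler_eq0 => /orP[|/eqP//].
rewrite -mulrBl opprK mulf_eq0 invr_eq0 (gt_eqF K_gt0) orbF.
by rewrite -[1 + 1]/(2%:R) pnatr_eq0.
Qed.

Lemma Pfpm_sub_mul (R : realType) n (E : {set {set 'I_n}}) (x y : 'cV[R]_#|E|) :
  Pfpm R E x -> Pfpm R E y -> incidence_mx R E *m (x - y) = 0.
Proof. by move=> [_ Ax] [_ Ay]; rewrite mulmxBr Ax Ay subrr. Qed.

(** With equal supports, [x - y] is a kernel vector supported inside that of [x]. *)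
Lemma support_extreme_point_inj (R : realType) n (E : {set {set 'I_n}}) :
  {in extreme_points (Pfpm R E) &, injective (@support R n E)}.
Proof.
move=> x y /[!inE] extr_x extr_y supp_xy; apply/eqP; rewrite -subr_eq0; apply/eqP.
apply: (extreme_point_perturb extr_x).
  by apply: Pfpm_sub_mul; [case: extr_x|case: extr_y].
move=> j /eqP xj0; have := enum_val_support y j.
rewrite -supp_xy enum_val_support xj0 => /esym/negbFE/eqP yj0.
by rewrite !mxE (eqP xj0) yj0 subrr.
Qed.

Lemma support_extreme_point (R : realType) n (E : {set {set 'I_n}})
    (x : 'cV[R]_#|E|) :
  extreme_points (Pfpm R E) x -> minimal_balanced R (support x).
Proof.
move=> extr_x; have [[x_ge0 Ax] _] := extr_x; split.
  exists (edge_weight x); split.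
    move=> S; rewrite inE lt_def => /andP[_ ->] /=.
    by apply: sumr_ge0 => j _; exact: x_ge0.
  rewrite -Ax (incidence_mx_mul (edge_weight_enum_val x)).
  rewrite [RHS](bigID (fun S => edge_weight x S != 0))/= [X in _ = _ + X]big1.
    by rewrite addr0; apply: eq_bigl => S; rewrite inE.
  by move=> S /andP[_ /negPn/eqP ->]; rewrite scale0r.
move=> Psi /properP[Psi_sub [S xS PsiS]] [lambda [lambda_gt0 sum_lambda]].
have sub_supp := fintype.subsetP Psi_sub.
(* Extending [lambda] by zero gives a point [y] of the polytope supported inside [x]. Perturbation
   forces [x = y], although [y] vanishes at [S] and [x] does not. *)
pose f T := if T \in Psi then lambda T else 0.
pose y : 'cV[R]_#|E| := \col_j f (enum_val j).
have Py : Pfpm R E y.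
  split; first by move=> j; rewrite mxE /f; case: ifP => // /lambda_gt0/ltW.
  rewrite (incidence_mx_mul (f := f)); last by move=> j; rewrite mxE.
  rewrite -sum_lambda (eq_bigr (fun T => if T \in Psi then lambda T *: char_vec R T else 0)).
    rewrite -big_mkcondr; apply: eq_bigl => T; rewrite andbC.
    by have [/sub_supp|//] := boolP (T \in Psi); rewrite inE => /andP[->].
  by move=> T _; rewrite /f; case: ifP => // _; rewrite scale0r.
have d0 : x - y = 0.
  apply: (extreme_point_perturb extr_x); first exact: Pfpm_sub_mul.
  move=> j xj0; rewrite !mxE xj0 /f; case: ifP => [/sub_supp|_]; last by rewrite subrr.
  by rewrite enum_val_support xj0 eqxx.
move: (xS); rewrite inE => /andP[ES].
rewrite -(enum_rankK_in ES ES) edge_weight_enum_val (subr0_eq d0) mxE /f.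
by rewrite enum_rankK_in// (negbTE PsiS) eqxx.
Qed.

Lemma finite_extreme_points (R : realType) n (E : {set {set 'I_n}}) :
  finite_set (extreme_points (Pfpm R E)).
Proof.
rewrite -(eq_finite_set (inj_card_eq (@support_extreme_point_inj R n E))).
exact: finite_finset.
Qed.

Lemma num_vert_Pfpm_leq (R : realType) n (E : {set {set 'I_n}}) :
  (num_vert_Pfpm R E <= num_minimal_balanced R n)%N.
Proof.
have fin := @finite_extreme_points R n E.
rewrite /num_vert_Pfpm /num_minimal_balanced [leqRHS]cardE -(size_map (@support R n E)).
apply: uniq_leq_size.
  rewrite map_inj_in_uniq ?fset_uniq// => x y; rewrite !in_fset_set//.
  exact: support_extreme_point_inj.
move=> _ /mapP[x + ->]; rewrite in_fset_set// inE => extr_x.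
by rewrite mem_enum; apply/asboolP; exact: support_extreme_point.
Qed.

Theorem lemmaC1 (R : realType) :
  (forall (n : nat) (E : {set {set 'I_n}}), (0 < n)%N -> finset.set0 \notin E ->
     finite_set (extreme_points (Pfpm R E)) /\
     (num_vert_Pfpm R E <= num_minimal_balanced R n)%N) /\
  (exists C : R, \forall n \near \oo,
     forall E : {set {set 'I_n}}, finset.set0 \notin E ->
       (num_vert_Pfpm R E)%:R <= C * (2 ^+ (n ^ 2 - n)%N / n`!%:R)).
Proof.
split=> [n E _ _|]; first by split; [exact: finite_extreme_points|exact: num_vert_Pfpm_leq].
exists 4; near=> n => E _.
rewrite (le_trans (y := (num_minimal_balanced R n)%:R)) ?ler_nat ?num_vert_Pfpm_leq//.
by apply: num_minimal_balanced_le; near: n; exact: nbhs_infty_ge.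
Unshelve. all: by end_near. Qed.
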